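(* Let $I^-_{RE}\subset (V\otimes V^* )^{\otimes 2}$ be the $(-1)$-eigenspace (skew-symmetric part) of the involution $\tau_{RE}$, and let $\mathcal{J}_{RE}$ be the two-sided ideal of the tensor algebra $\mathrm{T}(V\otimes V^* )$ generated by $I^-_{RE}$. Then the quotient algebra $\mathrm{T}(V\otimes V^* )/\mathcal{J}_{RE}$ is isomorphic to the reflection equation algebra $\mathcal{A}_{RE}(\mathcal{M})$.
   Context: Scalars: $\mathbb{C}(q)$, with fractional powers of $q$ adjoined when needed; $\omega=q-q^{-1}$. $\mathcal{M}$ is the algebra of $n\times n$ matrices with matrix units $e^i_j$, $e^i_je^k_l=\delta^k_j e^i_l$. The Hecke matrix is $$S=q\sum_i e^i_i\otimes e^i_i+\sum_{i\ne j}e^i_j\otimes e^j_i+\omega\sum_{i<k}e^i_i\otimes e^k_k\in\mathcal{M}\otimes\mathcal{M}.$$ $\mathcal{A}_{RE}(\mathcal{M})$ (the reflection equation algebra) is the associative unital algebra generated by the entries $L^i_j$ of the matrix $L=\sum_{i,j}L^i_j\,e^j_i$ subject to $L_2SL_2S=SL_2SL_2$, where $L_2=1\otimes L$. $V$ has basis $e_1,\dots,e_n$ and $V^*$ the dual basis $f^1,\dots,f^n$. Define: $\tau_{V\otimes V}(e_i\otimes e_i)=e_i\otimes e_i$ and, for $i\neq j$, $$\tau_{V\otimes V}(e_i\otimes e_j)=\mathrm{sign}(j-i)\tfrac{1-q^2}{1+q^2}\,e_i\otimes e_j+\tfrac{2q}{1+q^2}\,e_j\otimes e_i;$$ $\tau_{V^*\otimes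 V^*}(f^i\otimes f^i)=f^i\otimes f^i$ and, for $i\neq j$, $$\tau_{V^*\otimes V^*}(f^i\otimes f^j)=\mathrm{sign}(i-j)\tfrac{1-q^2}{1+q^2}\,f^i\otimes f^j+\tfrac{2q}{1+q^2}\,f^j\otimes f^i;$$ and $\tau_{V\otimes V^*}\colon V\otimes V^*\to V^*\otimes V$ by $\tau_{V\otimes V^*}(e_j\otimes f^i)=q^{-1/n}f^i\otimes e_j$ for $i\ne j$, $\tau_{V\otimes V^*}(e_i\otimes f^i)=q^{-1/n}\bigl(q f^i\otimes e_i+\omega\sum_{k>i}f^k\otimes e_k\bigr)$. On $(V\otimes V^* )^{\otimes2}=V\otimes V^*\otimes V\otimes V^*$ put $$\tau_{RE}=(\mathrm{id}\otimes\tau_{V\otimes V^*}\otimes\mathrm{id})\circ(\tau_{V\otimes V}\otimes\tau_{V^*\otimes V^*})\circ(\mathrm{id}\otimes\tau_{V\otimes V^*}^{-1}\otimes\mathrm{id}).$$ *)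

(* Defs.v *)
From HB Require Import structures.
From mathcomp Require Import all_boot all_order all_algebra.
From mathcomp Require Import boolp classical_sets reals.
From mathcomp Require Import complex mxtens.
From mathcomp.multinomials Require Import monalg.

Set Implicit Arguments.
Unset Strict Implicit.
Unset Printing Implicit Defensive.

Import GRing.Theory.

Local Open Scope ring_scope.
Local Open Scope quotient_scope.

(* Ideals are not required to be proper, so the quotient of an algebra by the
   two-sided ideal generated by a set is only a [pzRingType] and an [lmodType];
   [alg_quot_scalerAl] relates the two structures.  Closure of ideals under
   scalars follows from A being unital. *)

Section AlgQuotient.
Variables (K : fieldType) (A : lalgType K).
Implicit Types (G I : set A) (x y z : A).

Definition two_sided_ideal I : Prop :=
  [/\ I 0, forall x y, I x -> I y -> I (x + y),
      forall a x, I x -> I (a * x) & forall a x, I x -> I (x * a)].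

Definition ideal_gen G : set A := smallest two_sided_ideal G.

Lemma ideal_genP G : two_sided_ideal (ideal_gen G).
Proof.
split=> [|x y Ix Iy|a x Ix|a x Ix] I [II GI]; case: (II) => I0 ID Il Ir.
- exact: I0.
- by apply: ID; [apply: Ix|apply: Iy].
- by apply: Il; apply: Ix.
- by apply: Ir; apply: Ix.
Qed.

Section Quotient.
Variable G : set A.

Let I0 : ideal_gen G 0. Proof. by case: (ideal_genP G). Qed.
Let ID x y : ideal_gen G x -> ideal_gen G y -> ideal_gen G (x + y).
Proof. by case: (ideal_genP G) => _ H _ _; apply: H. Qed.
Let IMl a x : ideal_gen G x -> ideal_gen G (a * x).
Proof. by case: (ideal_genP G) => _ _ H _; apply: H. Qed.
Let IMr a x : ideal_gen G x -> ideal_gen G (x * a).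
Proof. by case: (ideal_genP G) => _ _ _ H; apply: H. Qed.
Let IZ c x : ideal_gen G x -> ideal_gen G (c *: x).
Proof. by move=> Ix; rewrite -[x]mul1r scalerAl; apply: IMl. Qed.
Let IN x : ideal_gen G x -> ideal_gen G (- x).
Proof. by move=> Ix; rewrite -scaleN1r; apply: IZ. Qed.

Definition ideal_equiv : rel A := fun x y => `[< ideal_gen G (x - y) >].

Lemma ideal_equiv_refl : reflexive ideal_equiv.
Proof. by move=> x; apply/asboolP; rewrite subrr. Qed.

Lemma ideal_equiv_sym : symmetric ideal_equiv.
Proof.
by move=> x y; apply/asboolP/asboolP => /IN; rewrite opprB.
Qed.

Lemma ideal_equiv_trans : transitive ideal_equiv.
Proof.
move=> y x z /asboolP Ixy /asboolP Iyz; apply/asboolP.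
by rewrite -[x](subrK y) -addrA; apply: ID.
Qed.

Canonical ideal_equivRel :=
  EquivRel ideal_equiv ideal_equiv_refl ideal_equiv_sym ideal_equiv_trans.

Definition alg_quot : Type := {eq_quot ideal_equiv}.

HB.instance Definition _ := Choice.on alg_quot.
HB.instance Definition _ := Quotient.on alg_quot.
HB.instance Definition _ := EqQuotient.on alg_quot.

Local Notation pi := (\pi_alg_quot).

Lemma pi_alg_quot_eq x y : pi x = pi y <-> ideal_gen G (x - y).
Proof.
split=> [/eqmodP/asboolP //|H].
by apply/eqmodP/asboolP.
Qed.

Let repr_pi x : ideal_gen G (repr (pi x) - x).
Proof. by apply/pi_alg_quot_eq; rewrite reprK. Qed.

Definition quot_add (u v : alg_quot) : alg_quot := pi (repr u + repr v).
Definition quot_opp (u : alg_quot) : alg_quot := pi (- repr u).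
Definition quot_mul (u v : alg_quot) : alg_quot := pi (repr u * repr v).
Definition quot_scale (c : K) (u : alg_quot) : alg_quot := pi (c *: repr u).

Let addE x y : quot_add (pi x) (pi y) = pi (x + y).
Proof. by apply/pi_alg_quot_eq; rewrite opprD addrACA; apply: ID. Qed.

Let oppE x : quot_opp (pi x) = pi (- x).
Proof. by apply/pi_alg_quot_eq; rewrite -opprD; apply: IN. Qed.

Let mulE x y : quot_mul (pi x) (pi y) = pi (x * y).
Proof.
apply/pi_alg_quot_eq.
rewrite -[_ * repr _](subrK (x * repr (pi y))) -mulrBl -addrA -mulrBr.
by apply: ID; [apply: IMr|apply: IMl].
Qed.

Let scaleE c x : quot_scale c (pi x) = pi (c *: x).
Proof. by apply/pi_alg_quot_eq; rewrite -scalerBr; apply: IZ. Qed.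

Let quotW (P : alg_quot -> Prop) : (forall x, P (pi x)) -> forall u, P u.
Proof. by move=> H u; rewrite -[u]reprK. Qed.

Fact quot_addA : associative quot_add.
Proof.
by elim/quotW=> x; elim/quotW=> y; elim/quotW=> z; rewrite !addE addrA.
Qed.
Fact quot_addC : commutative quot_add.
Proof. by elim/quotW=> x; elim/quotW=> y; rewrite !addE addrC. Qed.
Fact quot_add0 : left_id (pi 0) quot_add.
Proof. by elim/quotW=> x; rewrite addE add0r. Qed.
Fact quot_addN : left_inverse (pi 0) quot_opp quot_add.
Proof. by elim/quotW=> x; rewrite oppE addE addNr. Qed.

HB.instance Definition _ := GRing.isZmodule.Build alg_quot
  quot_addA quot_addC quot_add0 quot_addN.

Fact quot_mulA : associative quot_mul.
Proof.
by elim/quotW=> x; elim/quotW=> y; elim/quotW=> z; rewrite !mulE mulrA.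
Qed.
Fact quot_mul1l : left_id (pi 1) quot_mul.
Proof. by elim/quotW=> x; rewrite mulE mul1r. Qed.
Fact quot_mul1r : right_id (pi 1) quot_mul.
Proof. by elim/quotW=> x; rewrite mulE mulr1. Qed.
Fact quot_mulDl : left_distributive quot_mul +%R.
Proof.
elim/quotW=> x; elim/quotW=> y; elim/quotW=> z.
by rewrite /GRing.add /= !(addE, mulE) mulrDl.
Qed.
Fact quot_mulDr : right_distributive quot_mul +%R.
Proof.
elim/quotW=> x; elim/quotW=> y; elim/quotW=> z.
by rewrite /GRing.add /= !(addE, mulE) mulrDr.
Qed.

HB.instance Definition _ := GRing.Zmodule_isPzRing.Build alg_quot
  quot_mulA quot_mul1l quot_mul1r quot_mulDl quot_mulDr.

Fact quot_scaleA a b u : quot_scale a (quot_scale b u) = quot_scale (a * b) u.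
Proof. by elim/quotW: u => x; rewrite !scaleE scalerA. Qed.
Fact quot_scale1 : left_id 1 quot_scale.
Proof. by elim/quotW=> x; rewrite scaleE scale1r. Qed.
Fact quot_scaleDr : right_distributive quot_scale +%R.
Proof.
move=> a; elim/quotW=> x; elim/quotW=> y.
by rewrite /GRing.add /= !(addE, scaleE) scalerDr.
Qed.
Fact quot_scaleDl u : {morph quot_scale^~ u : a b / a + b}.
Proof.
by elim/quotW: u => x a b; rewrite /= [RHS]/GRing.add /= !(addE, scaleE) scalerDl.
Qed.

HB.instance Definition _ := GRing.Zmodule_isLmodule.Build K alg_quot
  quot_scaleA quot_scale1 quot_scaleDr quot_scaleDl.

Lemma pi_alg_quotD : {morph pi : x y / x + y}.
Proof. by move=> x y; rewrite [RHS]/GRing.add /= addE. Qed.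
Lemma pi_alg_quotM : {morph pi : x y / x * y}.
Proof. by move=> x y; rewrite [RHS]/GRing.mul /= mulE. Qed.
Lemma pi_alg_quot1 : pi 1 = 1. Proof. by []. Qed.
Lemma pi_alg_quotZ c : {morph pi : x / c *: x}.
Proof. by move=> x; rewrite [RHS]/GRing.scale /= scaleE. Qed.

Lemma alg_quot_scalerAl c (u v : alg_quot) : c *: (u * v) = c *: u * v.
Proof.
elim/quotW: u => x; elim/quotW: v => y.
by rewrite -pi_alg_quotM -!pi_alg_quotZ -pi_alg_quotM scalerAl.
Qed.

End Quotient.
End AlgQuotient.

Arguments alg_quot {K A} G.

(* Vector spaces with a chosen basis: [coord_space K X] has basis [bas x],
   [x : X].  The tensor product of [coord_space K X] and [coord_space K Y] is
   [coord_space K (X * Y)], with [bas (x, y)] for the tensor product of [bas x]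
   and [bas y]. *)

Section Tensor.
Variable K : fieldType.

Definition coord_space (X : finType) := {ffun X -> K^o}.

Definition bas (X : finType) (x : X) : coord_space X :=
  [ffun y => (y == x)%:R].

Section LinExt.
Variables (X Y : finType) (F : X -> coord_space Y).

Definition lin_ext_fun (v : coord_space X) : coord_space Y :=
  \sum_x v x *: F x.

Fact lin_ext_fun_is_linear : linear lin_ext_fun.
Proof.
move=> a u v; rewrite scaler_sumr -big_split /=; apply: eq_bigr => x _.
by rewrite !ffunE scalerDl scalerA.
Qed.

HB.instance Definition _ :=
  GRing.isLinear.Build K (coord_space X) (coord_space Y) *:%R lin_ext_fun
    lin_ext_fun_is_linear.

Definition lin_ext : 'Hom(coord_space X, coord_space Y) := linfun lin_ext_fun.

Lemma lin_ext_bas x : lin_ext (bas x) = F x.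
Proof.
rewrite /lin_ext lfunE /= /lin_ext_fun (bigD1 x) //= ffunE eqxx scale1r.
rewrite big1 ?addr0 // => y yx; by rewrite ffunE (negPf yx) scale0r.
Qed.

End LinExt.

Definition tensv (X Y : finType) (u : coord_space X) (v : coord_space Y) :
    coord_space (X * Y)%type :=
  [ffun p => u p.1 * v p.2].

Definition tens_hom (X Y X' Y' : finType)
    (f : 'Hom(coord_space X, coord_space X'))
    (g : 'Hom(coord_space Y, coord_space Y')) :
    'Hom(coord_space (X * Y)%type, coord_space (X' * Y')%type) :=
  lin_ext (fun p : X * Y => tensv (f (bas p.1)) (g (bas p.2))).

(* id (x) f (x) id, acting on the two inner factors of a fourfold tensor
   product bracketed as (12)(34) *)
Definition inner_hom (X Y Z T Y' Z' : finType)
    (f : 'Hom(coord_space (Y * Z)%type, coord_space (Y' * Z')%type)) :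
    'Hom(coord_space ((X * Y) * (Z * T))%type,
         coord_space ((X * Y') * (Z' * T))%type) :=
  lin_ext (fun p : (X * Y) * (Z * T) =>
    \sum_(r : Y' * Z') f (bas (p.1.2, p.2.1)) r *:
       bas ((p.1.1, r.1), (r.2, p.2.2))).

End Tensor.

Arguments bas {K X} x.
Arguments inner_hom {K} X {Y Z} T {Y' Z'} f.

(* Here [t] stands for q^(1/n).  Both V (basis e_i) and V^* (dual basis f^i)
   are [coord_space K 'I_n]: [bas (i, j)] is one of e_i (x) e_j, f^i (x) f^j,
   e_i (x) f^j, f^i (x) e_j according to the space it is meant to live in. *)

Section Tau.
Variables (K : fieldType) (n : nat) (t : K).

Local Notation q := (t ^+ n).
Local Notation omega := (q - q^-1).
Local Notation VV := (coord_space K ('I_n * 'I_n)%type).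
Local Notation VV2 := (coord_space K (('I_n * 'I_n) * ('I_n * 'I_n))%type).

Definition sign_sub (a b : nat) : K := (Num.sg (a%:Z - b%:Z))%:~R.

Definition tau_VV : 'Hom(VV, VV) :=
  lin_ext (fun p : 'I_n * 'I_n =>
    let: (i, j) := p in
    if i == j then bas (i, i)
    else (sign_sub j i * ((1 - q ^+ 2) / (1 + q ^+ 2))) *: bas (i, j)
         + (q *+ 2 / (1 + q ^+ 2)) *: bas (j, i)).

Definition tau_VdVd : 'Hom(VV, VV) :=
  lin_ext (fun p : 'I_n * 'I_n =>
    let: (i, j) := p in
    if i == j then bas (i, i)
    else (sign_sub i j * ((1 - q ^+ 2) / (1 + q ^+ 2))) *: bas (i, j)
         + (q *+ 2 / (1 + q ^+ 2)) *: bas (j, i)).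

(* [bas (j, i)] is e_j (x) f^i in the source, while [bas (i, j)] is
   f^i (x) e_j in the target *)
Definition tau_VVd : 'Hom(VV, VV) :=
  lin_ext (fun p : 'I_n * 'I_n =>
    let: (j, i) := p in
    if i == j then
      t^-1 *: (q *: bas (i, i) + omega *: \sum_(k < n | (i < k)%N) bas (k, k))
    else t^-1 *: bas (i, j)).

(* tau_VVd is invertible when t != 0; [^-1] is then its two-sided inverse. *)
Definition tau_RE : 'End(VV2) :=
  (inner_hom 'I_n 'I_n tau_VVd
   \o tens_hom tau_VV tau_VdVd
   \o inner_hom 'I_n 'I_n (tau_VVd^-1))%VF.

End Tau.

(* The free associative unital algebra on X is the monoid algebra of the free
   monoid of words in X. *)
Definition free_alg (K : fieldType) (X : choiceType) := {malg K[{fmonom X}]}.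
Definition free_gen (K : fieldType) (X : choiceType) (x : X) : free_alg K X :=
  << fmu x >>.

Section Algebras.
Variables (K : fieldType) (n : nat) (t : K).

Local Notation q := (t ^+ n).
Local Notation omega := (q - q^-1).
Local Notation VV2 := (coord_space K (('I_n * 'I_n) * ('I_n * 'I_n))%type).

(* The tensor algebra of V (x) V^*, as the free algebra on its basis
   e_i (x) f^j : a word of length k is a basis vector of the k-th tensor power *)
Definition tensor_alg := free_alg K ('I_n * 'I_n)%type.

Definition tensor2_incl (v : VV2) : tensor_alg :=
  \sum_(p : ('I_n * 'I_n) * ('I_n * 'I_n))
     v p *: (free_gen K p.1 * free_gen K p.2).

Definition I_RE : {vspace VV2} := passmx.leigenspace (tau_RE n t) (-1).

Definition skew_quotient : Type :=
  alg_quot [set tensor2_incl v | v in [set v | v \in I_RE]]%classic.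

Definition hecke_mx : 'M[K]_(n * n) :=
  q *: (\sum_i delta_mx i i *t delta_mx i i)
  + \sum_i \sum_(j | i != j) delta_mx i j *t delta_mx j i
  + omega *: (\sum_(i < n) \sum_(k < n | (i < k)%N)
                delta_mx i i *t delta_mx k k).

(* [free_gen K (i, j)] is the generator L^i_j *)
Definition RE_free := free_alg K ('I_n * 'I_n)%type.

Definition L_mx : 'M[RE_free]_n :=
  \sum_i \sum_j (free_gen K (i, j) : RE_free) *: delta_mx j i.

Definition L2_mx : 'M[RE_free]_(n * n) := 1%:M *t L_mx.

Definition S_mx : 'M[RE_free]_(n * n) :=
  map_mx (fun c : K => c%:A : RE_free) hecke_mx.

Definition RE_relation : 'M[RE_free]_(n * n) :=
  L2_mx *m S_mx *m L2_mx *m S_mx - S_mx *m L2_mx *m S_mx *m L2_mx.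

Definition RE_alg : Type :=
  alg_quot [set x | exists a b, x = RE_relation a b]%classic.

HB.instance Definition _ := GRing.PzRing.on skew_quotient.
HB.instance Definition _ := GRing.Lmodule.on skew_quotient.
HB.instance Definition _ := GRing.PzRing.on RE_alg.
HB.instance Definition _ := GRing.Lmodule.on RE_alg.

End Algebras.

(* C(q^(1/n)), written as C(t) with t^n = q *)
Definition q_field (R : realType) : fieldType := {fraction {poly R[i]}}.
Definition q_root (R : realType) : q_field R := tofrac 'X.

(* Main.v *)
Require Import Defs.
From HB Require Import structures.
From mathcomp Require Import all_boot all_order all_algebra.
From mathcomp Require Import reals.
From mathcomp Require Import boolp classical_sets.
From mathcomp Require Import complex mxtens ring.
From mathcomp.multinomials Require Import monalg.

Set Implicit Arguments.
Unset Strict Implicit.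
Unset Printing Implicit Defensive.

Import Order.TTheory GRing.Theory Num.Theory.

Local Open Scope ring_scope.

(* Put X = L_2 S L_2.  The defining relation of the reflection equation algebra
   says X S = S X.  Under the identification of e_x (x) f^y with the entry
   L_(x,y) = L^y_x, the map id (x) tau_(V (x) V^* ) (x) id sends
   e_(a2) (x) e_(a1) (x) f^(d1) (x) f^(d2) to t^-1 times the entry of X at row
   (a1, a2) and column (d1, d2), with t = q^(1/n).  Read on matrices of
   coefficients W, tau_(V (x) V) (x) tau_(V^* (x) V^* ) is W |-> M W M, where
   M = (2 S - omega) / (q + q^-1) is a symmetric involution by the Hecke
   relation S^2 = 1 + omega S.  Since M^2 = 1, the equation M W M = - W holds iff
   W is a commutator E S - S E, and pairing E S - S E with X gives the pairing of
   E with X S - S X.  Hence exchanging the two indices of the generators maps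
   I_RE onto the span of the reflection equation relations. *)

(** * Algebra maps between quotients by two-sided ideals *)

Section QuotientIso.
Local Open Scope quotient_scope.
Variable K : fieldType.

Lemma ideal_gen_sub (A : lalgType K) (G : set A) x : G x -> ideal_gen G x.
Proof. by move=> Gx I [_]; apply. Qed.

(** The preimage of a two-sided ideal under a ring morphism is a two-sided ideal, so minimality of
    [ideal_gen G] applies to the preimage of [ideal_gen H]. *)
Lemma ideal_gen_morph (A B : lalgType K) (G : set A) (H : set B)
    (f : {rmorphism A -> B}) :
  (forall x, G x -> ideal_gen H (f x)) ->
  forall x, ideal_gen G x -> ideal_gen H (f x).
Proof.
move=> GH x /(_ [set y | ideal_gen H (f y)]%classic); apply; split=> //.
case: (ideal_genP H) => H0 HD Hl Hr.
split=> [|y z Hy Hz|a y Hy|a y Hy] /=; rewrite ?rmorph0 ?rmorphD ?rmorphM //.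
- exact: HD.
- exact: Hl.
- exact: Hr.
Qed.

Section QuotMap.
Variables (A B : lalgType K) (G : set A) (H : set B).
Variables (f : {rmorphism A -> B}).
Hypothesis fGH : forall x, G x -> ideal_gen H (f x).

Definition quot_map (u : alg_quot G) : alg_quot H := \pi_(alg_quot H) (f (repr u)).

Lemma quot_map_pi x : quot_map (\pi_(alg_quot G) x) = \pi_(alg_quot H) (f x).
Proof.
apply/pi_alg_quot_eq; rewrite -rmorphB; apply: (ideal_gen_morph fGH).
by apply/pi_alg_quot_eq; rewrite reprK.
Qed.

End QuotMap.
Arguments quot_map {A B} G H f u.

(** Both [f] and [g] descend to the quotients, and the descended maps stay mutually inverse.
    Scalability is stated apart from the ring morphism because the quotients carry separate ring and
    module structures. *)
Lemma alg_quot_iso (A B : lalgType K) (G : set A) (H : set B)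
    (f : {lrmorphism A -> B}) (g : {lrmorphism B -> A}) :
  cancel f g -> cancel g f ->
  (forall x, G x -> ideal_gen H (f x)) ->
  (forall y, H y -> ideal_gen G (g y)) ->
  exists h : {rmorphism alg_quot G -> alg_quot H}, scalable h /\ bijective h.
Proof.
move=> fK gK fGH gHG.
have piW (C : lalgType K) (J : set C) (P : alg_quot J -> Prop) :
  (forall x, P (\pi_(alg_quot J) x)) -> forall u, P u.
  by move=> HP u; rewrite -[u]reprK.
pose h := quot_map G H f.
have hE x : h (\pi_(alg_quot G) x) = \pi_(alg_quot H) (f x) by exact: quot_map_pi.
have hD : {morph h : u v / u + v}.
  elim/piW=> x; elim/piW=> y.
  by rewrite -pi_alg_quotD !hE rmorphD -pi_alg_quotD.
have h0 : h 0 = 0.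
  by apply: (@addrI _ (h 0)); rewrite -hD !addr0.
have hM : {morph h : u v / u * v}.
  elim/piW=> x; elim/piW=> y.
  by rewrite -pi_alg_quotM !hE rmorphM -pi_alg_quotM.
have h1 : h 1 = 1 by rewrite -pi_alg_quot1 hE rmorph1.
pose aM := GRing.isNmodMorphism.Build _ _ h (conj h0 hD).
pose mM := GRing.isMonoidMorphism.Build _ _ h (conj h1 hM).
pose hh : {rmorphism alg_quot G -> alg_quot H} :=
  HB.pack h aM mM.
exists hh; split.
  by move=> c; elim/piW=> x; rewrite /= -pi_alg_quotZ !hE linearZ -pi_alg_quotZ.
exists (quot_map H G g); elim/piW=> x /=.
  by rewrite hE (quot_map_pi gHG); congr (\pi_(_) _); apply: fK.
by rewrite (quot_map_pi gHG) hE; congr (\pi_(_) _); apply: gK.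
Qed.

End QuotientIso.

(** * Functoriality of the free algebra in its set of generators *)

Section FreeAlgMap.
Variables (K : fieldType) (X Y : choiceType) (s : X -> Y).

Let h (m : {fmonom X}) : free_alg K Y := << FMonom (map s m) >>.

Let h_mmorphism : mmorphism h.
Proof.
split=> [x y|]; rewrite /h.
  rewrite [RHS]fgmulUU mulr1; congr << _ *g _ >>.
  by apply/eqP; rewrite fmP fmM /= fmM map_cat.
rewrite fm1 /=; congr << _ *g _ >>.
by apply/eqP; rewrite fmP fm1.
Qed.

HB.instance Definition _ :=
  isMultiplicative.Build {fmonom X} (free_alg K Y) h h_mmorphism.

Definition free_alg_map : free_alg K X -> free_alg K Y :=
  mmap (@malgC {fmonom Y} K) h.

HB.instance Definition _ := GRing.Additive.on free_alg_map.

(** For a noncommutative target, multiplicativity requires the images of coefficients to commute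
    with the images of words. This holds since constants are central in the free algebra. *)
Fact free_alg_map_multiplicative : multiplicative free_alg_map.
Proof.
apply: commr_mmap_is_multiplicative => g m m'.
apply: esym; rewrite /GRing.comm malgM_def fgmulgU.
rewrite malgM_def fgmulUg; apply: eq_bigr => k _.
by rewrite mulrC mulm1 mul1m.
Qed.

HB.instance Definition _ := GRing.isMultiplicative.Build
  (free_alg K X) (free_alg K Y) free_alg_map free_alg_map_multiplicative.

Fact free_alg_map_scalable : scalable free_alg_map.
Proof. by move=> c g; rewrite /free_alg_map mmapZ mul_malgC. Qed.

HB.instance Definition _ := GRing.isScalable.Build K
  (free_alg K X) (free_alg K Y) *:%R free_alg_map free_alg_map_scalable.

Lemma free_alg_mapU c m :
  free_alg_map << c *g m >> = << c *g FMonom (map s m) >>.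
Proof. by rewrite /free_alg_map mmapU malgM_def fgmulUU mulr1 mul1m. Qed.

Lemma free_alg_map_gen x : free_alg_map (free_gen K x) = free_gen K (s x).
Proof. by rewrite free_alg_mapU fmU /= /free_gen fmuE. Qed.

End FreeAlgMap.

Lemma free_alg_mapK (K : fieldType) (X Y : choiceType) (s : X -> Y) (r : Y -> X) :
  cancel s r -> cancel (@free_alg_map K X Y s) (free_alg_map r).
Proof.
move=> sK g; rewrite [in RHS](monalgE g) [in LHS](monalgE g).
rewrite (raddf_sum (@free_alg_map K X Y s)) (raddf_sum (free_alg_map r)).
by apply: eq_bigr => m _ /=; rewrite !free_alg_mapU /= mapK ?fmK.
Qed.

(** * Coordinates, and functoriality of id (x) f (x) id *)

Section CoordSpace.
Variable K : fieldType.

Lemma coord_space_sum (X : finType) (v : coord_space K X) :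
  v = \sum_x v x *: bas x.
Proof.
apply/ffunP => y; rewrite sum_ffunE (bigD1 y) //= big1 => [|x xy].
  by rewrite !ffunE eqxx addr0 /GRing.scale /= mulr1.
by rewrite !ffunE eq_sym (negPf xy) /GRing.scale /= mulr0.
Qed.

Lemma lin_extE (X Y : finType) (F : X -> coord_space K Y) v y :
  lin_ext F v y = \sum_x v x * F x y.
Proof.
rewrite /lin_ext lfunE /= /lin_ext_fun sum_ffunE.
by apply: eq_bigr => x _; rewrite ffunE.
Qed.

Lemma eq_lfun_bas (X Y : finType)
    (f g : 'Hom(coord_space K X, coord_space K Y)) :
  (forall x, f (bas x) = g (bas x)) -> f = g.
Proof.
move=> fg; apply/lfunP => v; rewrite [v]coord_space_sum !linear_sum.
by apply: eq_bigr => x _; rewrite !linearZ /= fg.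
Qed.

(** Together with [inner_hom1], this lets an inverse of f yield an inverse of id (x) f (x) id. *)
Lemma inner_homM (X Y Z T Y' Z' Y'' Z'' : finType)
    (f : 'Hom(coord_space K (Y' * Z')%type, coord_space K (Y'' * Z'')%type))
    (g : 'Hom(coord_space K (Y * Z)%type, coord_space K (Y' * Z')%type)) :
  (inner_hom X T f \o inner_hom X T g)%VF = inner_hom X T (f \o g)%VF.
Proof.
apply: eq_lfun_bas => -[[x y] [z u]]; rewrite comp_lfunE !lin_ext_bas /=.
rewrite linear_sum comp_lfunE; set v := g _.
under [RHS]eq_bigr => r _ do
  rewrite {1}[v]coord_space_sum linear_sum sum_ffunE scaler_suml.
rewrite exchange_big; apply: eq_bigr => -[y' z'] _.
rewrite linearZ /= lin_ext_bas /= scaler_sumr; apply: eq_bigr => r _.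
by rewrite scalerA linearZ ffunE.
Qed.

Lemma inner_hom1 (X Y Z T : finType) :
  inner_hom X T (\1 : 'End(coord_space K (Y * Z)%type))%VF = \1%VF.
Proof.
apply: eq_lfun_bas => -[[x y] [z u]]; rewrite lin_ext_bas !id_lfunE /=.
rewrite (bigD1 (y, z)) //= ffunE eqxx scale1r big1 ?addr0 // => r ryz.
by rewrite ffunE (negPf ryz) scale0r.
Qed.

End CoordSpace.

Lemma mulr_natb_sum (R : pzRingType) (I : finType) (i : I) (F : I -> R) :
  \sum_j (j == i)%:R * F j = F i.
Proof.
rewrite (bigD1 i) //= eqxx mul1r big1 ?addr0 // => j /negPf ->.
exact: mul0r.
Qed.

(** * The Hecke matrix: entries, symmetry and quadratic relation *)

Section Hecke.
Variables (K : fieldType) (n : nat) (t : K).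
Hypothesis t_neq0 : t != 0.
Local Notation q := (t ^+ n).
Local Notation omega := (q - q^-1).
Local Notation S := (hecke_mx n t).
Local Notation pr := ('I_n * 'I_n)%type.
Local Notation idx := (@mxtens_index n n).

Definition swap (X Y : Type) (p : X * Y) : Y * X := (p.2, p.1).

Let q_neq0 : q != 0. Proof. exact: expf_neq0. Qed.

Lemma hecke_mxE (a b : pr) :
  S (idx a) (idx b) =
    (b == swap a)%:R * (if a.1 == a.2 then q else 1)
    + omega * (a.1 < a.2)%N%:R * (b == a)%:R.
Proof.
case: a b => [a1 a2] [b1 b2]; rewrite /swap /= !xpair_eqE.
(* In each of the three sums defining S, the row (a1, a2) forces the outer summation index to be
   a1. *)
have sumE (F : 'I_n -> K) (A : 'I_n -> 'M[K]_(n * n)) c :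
    (forall i, A i (idx (a1, a2)) (idx (b1, b2)) = (i == c)%:R * F i) ->
    (\sum_i A i) (idx (a1, a2)) (idx (b1, b2)) = F c.
  by move=> AE; rewrite summxE (eq_bigr _ (fun i _ => AE i)) mulr_natb_sum.
rewrite /hecke_mx [LHS]mxE [X in X + _]mxE [X in X + _ + _]mxE [X in _ + _ + X]mxE.
rewrite (sumE (fun i => ((b1 == i) && (a2 == i) && (b2 == i))%:R) _ a1); last first.
  move=> i; rewrite tensmxE !mxE -!natrM !mulnb eq_sym.
  by congr (_%:R); rewrite !andbA.
rewrite (sumE (fun i => ((a2 != i) && (b1 == a2) && (b2 == i))%:R) _ a1); last first.
  move=> i; rewrite summxE big_mkcond /= (bigD1 a2) //= big1 => [|j ja]; last first.
    by case: ifP => // _; rewrite tensmxE !mxE (eq_sym a2) (negPf ja) mulr0.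
  rewrite addr0 tensmxE !mxE eqxx /= (eq_sym i a1) (eq_sym i a2) -!natrM !mulnb.
  by case: (a2 == i); rewrite /= ?andbF ?andbA.
rewrite (sumE (fun i => ((b1 == i) && ((i < a2)%N && (b2 == a2)))%:R) _ a1); last first.
  move=> i; rewrite summxE big_mkcond /= (bigD1 a2) //= big1 => [|j ja]; last first.
    by case: ifP => // _; rewrite tensmxE !mxE (eq_sym a2) (negPf ja) mulr0.
  rewrite addr0 tensmxE !mxE eqxx /= (eq_sym i a1) -!natrM !mulnb.
  by case: (i < a2)%N; rewrite /= ?andbF ?andbA.
rewrite (eq_sym a2 a1); case: (eqVneq a1 a2) => [<-|a12].
  by rewrite ltnn /= andbT andbF !(mulr0, mul0r, addr0) mulrC.
rewrite !andbF /= mulr0 add0r mulr1; congr (_ + _).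
by rewrite -mulrA -natrM mulnb andbCA.
Qed.

Lemma hecke_mx_sym : S^T = S.
Proof.
apply/matrixP => i j; rewrite mxE.
case: (mxtens_indexP i) => a1 a2; case: (mxtens_indexP j) => b1 b2.
rewrite !hecke_mxE /swap /= !xpair_eqE.
rewrite (eq_sym b1 a1) (eq_sym b2 a2) (eq_sym a1 b2) (eq_sym a2 b1) andbC.
congr (_ + _).
  case: (eqVneq b1 a2) => [->|_]; last by rewrite !mul0r.
  case: (eqVneq b2 a1) => [->|_]; last by rewrite !mul0r.
  by rewrite eq_sym.
case: (eqVneq a1 b1) => [->|_]; last by rewrite !mulr0.
by case: (eqVneq a2 b2) => [->|_]; last by rewrite !mulr0.
Qed.

Lemma sum_mxtens (V : nmodType) (F : 'I_(n * n) -> V) :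
  \sum_i F i = \sum_(p : pr) F (idx p).
Proof.
apply: reindex; exists (@mxtens_unindex n n) => p _.
  exact: mxtens_indexK.
exact: mxtens_unindexK.
Qed.

(** By [hecke_mxE], row a of S is supported on the columns [swap a] and a, so an entry of the square
    has at most two terms. The order of a1 and a2 then decides the case; for a1 = a2 the identity is
    q^2 = 1 + omega q. *)
Lemma hecke_mx_sqr : S *m S = 1%:M + omega *: S.
Proof.
apply/matrixP => i j; rewrite mxE.
case: (mxtens_indexP i) => a1 a2.
rewrite sum_mxtens.
under eq_bigr => c _ do rewrite hecke_mxE mulrDl mulrAC -mulrA
  [omega * _ * _]mulrC -mulrA.
rewrite big_split /= !mulr_natb_sum /swap /=.
rewrite [RHS]mxE [X in _ = X + _]mxE [X in _ = _ + X]mxE.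
case: (mxtens_indexP j) => b1 b2.
rewrite (inj_eq (can_inj (@mxtens_indexK n n))).
rewrite !hecke_mxE /swap /= !xpair_eqE.
rewrite (eq_sym a1 b1) (eq_sym a2 b2) (eq_sym a2 a1).
have [lt21|lt12|eq12] := ltngtP a1 a2.
- have ne: a1 == a2 = false by apply/negbTE; rewrite neq_ltn lt21.
  by rewrite ne /=; ring.
- have ne: a1 == a2 = false by apply/negbTE; rewrite neq_ltn lt12 orbT.
  by rewrite ne /=; ring.
- have -> : a1 = a2 by apply: val_inj.
  by rewrite eqxx andbC /=; field; apply: q_neq0.
Qed.

End Hecke.

(** * The three braidings expressed through the Hecke matrix *)

Section Braiding.
Variables (K : fieldType) (n : nat) (t : K).
Hypothesis t_neq0 : t != 0.
Local Notation q := (t ^+ n).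
Local Notation omega := (q - q^-1).
Local Notation S := (hecke_mx n t).
Local Notation pr := ('I_n * 'I_n)%type.
Local Notation idx := (@mxtens_index n n).

Let q_neq0 : q != 0. Proof. exact: expf_neq0. Qed.

(** Up to t^-1, this braiding is S with indices regrouped: the source pair (x, y) supplies the first
    tensor factor of S, the target pair (u, v) the second. *)
Lemma tau_VVd_hecke (x y u v : 'I_n) :
  tau_VVd n t (bas (x, y)) (u, v) = t^-1 * S (idx (x, u)) (idx (y, v)).
Proof.
rewrite hecke_mxE /swap lin_ext_bas /= !xpair_eqE (eq_sym y u) (eq_sym y x) (eq_sym x u).
case: (eqVneq x y) => [<-|xy].
  rewrite !ffunE sum_ffunE [in LHS]/GRing.scale /=.
  have -> : \sum_(k < n | (x < k)%N) bas (k, k) (u, v) =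
      ((x < u)%N && (v == u))%:R :> K.
    rewrite big_mkcond (bigD1 u) //= big1 => [|k ku]; last first.
      by case: ifP; rewrite // ffunE xpair_eqE eq_sym (negPf ku).
    by rewrite addr0 ffunE xpair_eqE eqxx /=; case: ifP.
  rewrite xpair_eqE; congr (_ * (_ + _)).
    by rewrite mulrC; case: (eqVneq u x) => _ //; rewrite !mul0r.
  by rewrite -mulnb natrM mulrA.
rewrite !ffunE [LHS]/GRing.scale /= mulr0 addr0 xpair_eqE.
case: (eqVneq u y) => [->|_] /=; last by rewrite !mul0r.
by rewrite (eq_sym y x) (negPf xy) mulr1.
Qed.

(** The map is a flip off the diagonal and triangular on the diagonal vectors, with nonzero diagonal
    coefficient q t^-1. *)
Lemma tau_VVd_inj : lker (tau_VVd n t) == 0%VS.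
Proof.
apply/lker0P => v w /(congr1 (fun f => f - tau_VVd n t w)).
rewrite subrr -linearB /= => vw0; apply/subr0_eq.
move: (v - w) vw0 => {w}v v0.
have tv (p : pr) : \sum_r v r * S (idx (r.1, p.1)) (idx (r.2, p.2)) = 0.
  move/(congr1 (fun f : coord_space K _ => t * f p)): v0.
  rewrite /= [v in LHS]coord_space_sum linear_sum sum_ffunE ffunE mulr0 => {2}<-.
  rewrite mulr_sumr; apply: eq_bigr => -[x y] _.
  rewrite linearZ ffunE [X in _ = t * X]/GRing.scale /= [p in RHS]surjective_pairing.
  by rewrite tau_VVd_hecke mulrCA (mulrA t) divff // mul1r.
(* For x != y, the coordinate (y, x) of the image involves only v (x, y). *)
have vneq x y : x != y -> v (x, y) = 0.
  move=> xy; have := tv (y, x); rewrite (bigD1 (x, y)) //=.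
  rewrite hecke_mxE /swap /= eqxx (negPf xy) mulr1 xpair_eqE (eq_sym y) (negPf xy) /=.
  rewrite mulr0 addr0 mulr1 big1 ?addr0 // => -[z u] zu.
  rewrite hecke_mxE /swap /= !xpair_eqE (eq_sym x z) (eq_sym x y) (eq_sym u y).
  rewrite (eq_sym y u) andbC -xpair_eqE (negPf zu) mul0r add0r.
  case: (eqVneq y x) => [yx|_]; first by rewrite yx eqxx in xy.
  by rewrite andbF !mulr0.
apply/ffunP => -[x y]; rewrite ffunE.
case: (eqVneq x y) => [<-{y}|/vneq //].
(* Coordinate (x, x) reads q v (x, x) + omega times the sum of v (z, z) over z < x, so strong
   induction on x removes the sum. *)
have [m] := ubnP x; elim: m => // m IHm in x *; rewrite ltnS => xm.
have := tv (x, x); rewrite (bigD1 (x, x)) //= big1 ?addr0 => [|[z u] zu].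
  rewrite hecke_mxE /swap /= !eqxx ltnn mul1r mulr0 mul0r addr0 => /eqP.
  by rewrite mulf_eq0 (negPf q_neq0) orbF => /eqP.
case: (eqVneq z u) => [zu'|/vneq ->]; last by rewrite mul0r.
have [zx|xz|zx] := ltngtP z x.
- by rewrite -zu' IHm ?mul0r // (leq_trans zx).
- rewrite hecke_mxE /swap /= !xpair_eqE (eq_sym x z).
  have /negPf-> : z != x by rewrite neq_ltn xz orbT.
  by rewrite andbF ltnNge (ltnW xz) /= !mulr0 !mul0r addr0 mulr0.
- by move: zu; rewrite -zu' (_ : z = x) ?eqxx //; apply: val_inj.
Qed.

(* S has eigenvalues q and - q^-1; this is the polynomial in S taking the
   values 1 and -1 on them. *)
Definition hecke_invol : 'M[K]_(n * n) :=
  (q + q^-1)^-1 *: (2 *: S - omega%:M).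
Local Notation M := hecke_invol.

Lemma hecke_involE (a b : pr) :
  M (idx a) (idx b) =
    (q + q^-1)^-1 * (2 * S (idx a) (idx b) - omega * (a == b)%:R).
Proof.
rewrite /M; move: S => s.
by rewrite !mxE (inj_eq (can_inj (@mxtens_indexK n n))) mulr_natr.
Qed.

Lemma tr_hecke_invol : M^T = M.
Proof. by rewrite /M !linearZ linearB linearZ /= hecke_mx_sym tr_scalar_mx. Qed.

Hypothesis q2_neq0 : 1 + q ^+ 2 != 0.

(** By the Hecke relation, (2 S - omega)^2 = 4 + omega^2 = (q + q^-1)^2. The hypothesis 1 + q^2 != 0
    makes q + q^-1 invertible. *)
Lemma hecke_involK : M *m M = 1%:M.
Proof.
rewrite /M -scalemxAl -scalemxAr scalerA mulmxBl !mulmxBr.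
rewrite -!scalemxAl -!scalemxAr -scalar_mxM mul_scalar_mx mul_mx_scalar.
rewrite hecke_mx_sqr //.
move: S (q) q_neq0 q2_neq0 => s x x0 x20.
apply/matrixP => i j; rewrite !mxE.
by case: (i == j); rewrite ?mulr1n ?mulr0n; field; rewrite x0 -expr2 addrC x20.
Qed.

Lemma sign_sub_lt (a b : nat) : (a < b)%N -> sign_sub K a b = -1.
Proof. by move=> ab; rewrite /sign_sub ltr0_sg ?rmorphN1 // subr_lt0 ltz_nat. Qed.

Lemma sign_sub_gt (a b : nat) : (b < a)%N -> sign_sub K a b = 1.
Proof. by move=> ab; rewrite /sign_sub gtr0_sg // subr_gt0 ltz_nat. Qed.

(** For unequal indices the flip coefficient of M is 2 / (q + q^-1) = 2 q / (1 + q^2), and its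
    diagonal coefficient is omega / (q + q^-1) up to the sign of the ordering. For equal indices M
    gives 1, since 2 q - omega = q + q^-1. *)
Lemma tau_VdVd_hecke (d c : pr) :
  tau_VdVd n t (bas d) c = M (idx c) (idx d).
Proof.
(* Transposing makes d the row index, so that [hecke_mxE] and [tau_VdVd] split on the same pair. *)
rewrite -tr_hecke_invol mxE.
case: d c => [d1 d2] [c1 c2].
rewrite hecke_involE hecke_mxE /swap lin_ext_bas /= !xpair_eqE (eq_sym d1 c1) (eq_sym d2 c2).
have -> : q *+ 2 / (1 + q ^+ 2) = q * 2 / (1 + q ^+ 2) by rewrite mulr_natr.
have [lt12|lt21|eq12] := ltngtP d1 d2.
- have ne: d1 == d2 = false by apply/negbTE; rewrite neq_ltn lt12.
  rewrite ne sign_sub_lt // !ffunE !xpair_eqE /GRing.scale /=.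
  by move: (q) q_neq0 q2_neq0 => x x0 x20; field; rewrite x0 -expr2 addrC x20.
- have ne: d1 == d2 = false by apply/negbTE; rewrite neq_ltn lt21 orbT.
  rewrite ne sign_sub_gt // !ffunE !xpair_eqE /GRing.scale /=.
  by move: (q) q_neq0 q2_neq0 => x x0 x20; field; rewrite x0 -expr2 addrC x20.
- have <- : d1 = d2 by apply: val_inj.
  rewrite eqxx !ffunE !xpair_eqE /GRing.scale /=.
  by move: (q) q_neq0 q2_neq0 => x x0 x20; field; rewrite x0 -expr2 addrC x20.
Qed.

(* The two tensor factors of V (x) V are read in reverse order, because the
   defining signs of tau_VV and tau_VdVd are opposite. *)
Lemma tau_VV_hecke (a c : pr) :
  tau_VV n t (bas (swap a)) (swap c) = M (idx c) (idx a).
Proof.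
rewrite -tau_VdVd_hecke; case: a c => [a1 a2] [c1 c2].
rewrite !lin_ext_bas /= eq_sym; case: (eqVneq a1 a2) => [->|_].
  by rewrite !ffunE !xpair_eqE andbC.
by rewrite !ffunE !xpair_eqE; congr (_ *: _%:R + _ *: _%:R); rewrite andbC.
Qed.

End Braiding.

Lemma sum_pairE (V : nmodType) (X Y : finType) (F : X * Y -> V) :
  \sum_p F p = \sum_x \sum_y F (x, y).
Proof. by rewrite pair_bigA; apply: eq_bigr => -[]. Qed.

(** * Linearity of the inclusion of degree two tensors *)

Section Tensor2Incl.
Variables (K : fieldType) (n : nat).
Local Notation pr := ('I_n * 'I_n)%type.

Fact tensor2_incl_is_linear : linear (@tensor2_incl K n).
Proof.
move=> a u v; rewrite /tensor2_incl scaler_sumr -big_split.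
by apply: eq_bigr => p _; rewrite !ffunE scalerDl scalerA.
Qed.

HB.instance Definition _ :=
  GRing.isLinear.Build K (coord_space K (pr * pr)%type) (tensor_alg K n) *:%R
    (@tensor2_incl K n) tensor2_incl_is_linear.

Lemma tensor2_incl_bas x y :
  @tensor2_incl K n (bas (x, y)) = free_gen K x * free_gen K y.
Proof.
rewrite /tensor2_incl (bigD1 (x, y)) //= ffunE eqxx scale1r big1 ?addr0 // => p.
by rewrite ffunE => /negPf ->; rewrite scale0r.
Qed.

End Tensor2Incl.

(** * Pairing scalar matrices with matrices over an algebra *)

Section MxPairing.
Variables (K : fieldType) (A : lmodType K) (m : nat).

(** This is the trace form tr(W^T Y). *)
Definition mx_pairing (W : 'M[K]_m) (Y : 'M[A]_m) : A :=
  \sum_i \sum_j W i j *: Y i j.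

Lemma mx_pairing_delta i j Y : mx_pairing (delta_mx i j) Y = Y i j.
Proof.
rewrite /mx_pairing (bigD1 i) //= (bigD1 j) //= mxE !eqxx scale1r.
rewrite !big1 ?addr0 // => [i' /negPf i'i|j' /negPf j'j]; last first.
  by rewrite mxE j'j andbF scale0r.
by apply: big1 => j' _; rewrite mxE i'i scale0r.
Qed.

End MxPairing.

(** Right multiplication by T is adjoint to right multiplication by T^T, and likewise on the left;
    here T^T = T. Centrality of scalars turns right multiplication by an entry of [Ta] into
    scaling. *)
Lemma mx_pairing_commutator (K : fieldType) (A : lalgType K) (m : nat)
    (W T : 'M[K]_m) (X : 'M[A]_m) :
  (forall c (x : A), x * c%:A = c *: x) ->
  T^T = T ->
  let Ta := map_mx (fun c : K => c%:A : A) T in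
  mx_pairing (W *m T - T *m W) X = mx_pairing W (X *m Ta - Ta *m X).
Proof.
move=> central Tsym Ta; have TE i j : T i j = T j i by rewrite -[in LHS]Tsym mxE.
rewrite /mx_pairing.
under eq_bigr => i _ do under eq_bigr => j _ do rewrite mxE [X in _ + X]mxE scalerBl.
under [RHS]eq_bigr => i _ do under eq_bigr => j _ do rewrite mxE [X in _ + X]mxE scalerBr.
under eq_bigr => i _ do rewrite sumrB.
under [RHS]eq_bigr => i _ do rewrite sumrB.
rewrite !sumrB; congr (_ - _).
  apply: eq_bigr => i _.
  under eq_bigr => j _ do rewrite mxE scaler_suml.
  rewrite exchange_big; apply: eq_bigr => k _.
  rewrite mxE scaler_sumr; apply: eq_bigr => j _.
  by rewrite !mxE central -scalerA TE.
rewrite exchange_big [RHS]exchange_big; apply: eq_bigr => j _.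
under eq_bigr => i _ do rewrite mxE scaler_suml.
rewrite exchange_big; apply: eq_bigr => k _.
rewrite mxE scaler_sumr; apply: eq_bigr => i _.
by rewrite !mxE -scalerAl mul1r scalerA mulrC TE.
Qed.

(** * Matching the skew-symmetric tensors with the reflection equation relations *)

Section SkewIso.
Variables (K : fieldType) (n : nat) (t : K).
Hypothesis t_neq0 : t != 0.
Local Notation q := (t ^+ n).
Local Notation omega := (q - q^-1).
Hypothesis q2_neq0 : 1 + q ^+ 2 != 0.
Hypothesis two_neq0 : 2 != 0 :> K.
Local Notation S := (hecke_mx n t).
Local Notation M := (hecke_invol n t).
Local Notation pr := ('I_n * 'I_n)%type.
Local Notation idx := (@mxtens_index n n).
Local Notation VV2 := (coord_space K (pr * pr)%type).
Local Notation A := (free_alg K pr).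

Lemma free_alg_scalar_comm (c : K) (x : A) : x * c%:A = c *: x.
Proof.
rewrite -mul_malgC mulr1 malgM_def fgmulgU -mul_malgC malgM_def fgmulUg.
by apply: eq_bigr => k _; rewrite mulrC mulm1 mul1m.
Qed.

Definition LSL_mx : 'M[A]_(n * n) := L2_mx K n *m S_mx n t *m L2_mx K n.

Lemma RE_relationE :
  RE_relation n t = LSL_mx *m S_mx n t - S_mx n t *m LSL_mx.
Proof. by rewrite /RE_relation /LSL_mx !mulmxA. Qed.

Lemma L_mxE i j : L_mx K n i j = free_gen K (j, i).
Proof.
have colE k : (\sum_l (free_gen K (k, l) : RE_free K n) *: delta_mx l k : 'M_n) i j =
    (k == j)%:R * free_gen K (k, i).
  rewrite summxE.
  under eq_bigr => l _.
    rewrite mxE mxE.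
    over.
  rewrite (bigD1 i) //= eqxx (eq_sym j) big1 => [|l /negPf li].
    by rewrite addr0; case: (k == j); rewrite ?(mulr0, mul0r, mulr1, mul1r).
  by rewrite (eq_sym i) li mulr0.
rewrite /L_mx summxE (eq_bigr _ (fun k _ => colE k)).
exact: mulr_natb_sum.
Qed.

(** The identity factor of L_2 = 1 (x) L fixes the first index on each side of S, leaving a sum over
    the two second indices. Its coefficients are those of [tau_VVd_hecke], up to t^-1. *)
Lemma LSL_mxE (a d : pr) :
  LSL_mx (idx a) (idx d) =
  \sum_(r : pr) S (idx (a.1, r.1)) (idx (d.1, r.2)) *:
     (free_gen K (r.1, a.2) * free_gen K (d.2, r.2)).
Proof.
case: a d => [a1 a2] [d1 d2].
have L2E x1 x2 y1 y2 : L2_mx K n (idx (x1, x2)) (idx (y1, y2)) =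
    (x1 == y1)%:R * free_gen K (y2, x2).
  by rewrite tensmxE L_mxE mxE.
have pair_delta (i : 'I_n) (F : pr -> A) :
    \sum_p (p.1 == i)%:R * F p = \sum_j F (i, j).
  rewrite sum_pairE exchange_big /=.
  by apply: eq_bigr => j _; rewrite mulr_natb_sum.
have mulrA3 (Q : pzRingType) (x y z u : Q) : x * y * z * u = x * (y * (z * u)).
  by rewrite !mulrA.
rewrite mxE sum_mxtens.
rewrite (eq_bigr (fun k : pr => (k.1 == d1)%:R *
    ((L2_mx K n *m S_mx n t) (idx (a1, a2)) (idx k) * free_gen K (d2, k.2)))); last first.
  move=> [k1 k2] _; rewrite L2E /=.
  by case: (k1 == d1); rewrite ?(mul0r, mulr0, mul1r).
rewrite pair_delta sum_pairE exchange_big /=.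
apply: eq_bigr => c _; rewrite mxE sum_mxtens mulr_suml.
rewrite (eq_bigr (fun k : pr => (k.1 == a1)%:R * (free_gen K (k.2, a2) *
    (S_mx n t (idx k) (idx (d1, c)) * free_gen K (d2, c))))); last first.
  move=> [k1 k2] _; rewrite L2E /= eq_sym.
  exact: mulrA3.
rewrite pair_delta; apply: eq_bigr => b _ /=.
by rewrite mxE mulrA free_alg_scalar_comm scalerAl.
Qed.

(** Rows read the V (x) V part with its factors reversed, as required by [tau_VV_hecke]; columns
    read the dual part in order. *)
Definition mx_of_tensor (w : VV2) : 'M[K]_(n * n) :=
  \matrix_(a, d) w (swap (mxtens_unindex a), mxtens_unindex d).

Lemma mx_of_tensorE w (a d : pr) : mx_of_tensor w (idx a) (idx d) = w (swap a, d).
Proof. by rewrite mxE !mxtens_indexK. Qed.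

Lemma mx_of_tensorN w : mx_of_tensor (- w) = - mx_of_tensor w.
Proof. by apply/matrixP => i j; rewrite !mxE ffunE. Qed.

Definition tensor_of_mx (W : 'M[K]_(n * n)) : VV2 :=
  [ffun p => W (idx (swap p.1)) (idx p.2)].

Lemma tensor_of_mxK : cancel tensor_of_mx mx_of_tensor.
Proof.
move=> W; apply/matrixP => i j; rewrite mxE ffunE /=.
by case: (mxtens_indexP i) => a1 a2; rewrite mxtens_indexK mxtens_unindexK.
Qed.

Lemma mx_of_tensorK : cancel mx_of_tensor tensor_of_mx.
Proof.
move=> w; apply/ffunP => -[[a1 a2] d]; rewrite ffunE mxE.
by rewrite !mxtens_indexK.
Qed.

Local Notation sigma := (tens_hom (tau_VV n t) (tau_VdVd n t)).

Lemma mx_of_tensor_sigma w :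
  mx_of_tensor (sigma w) = M *m mx_of_tensor w *m M.
Proof.
apply/matrixP => i j.
case: (mxtens_indexP i) => a1 a2; case: (mxtens_indexP j) => b1 b2.
rewrite mx_of_tensorE lin_extE mxE sum_mxtens sum_pairE exchange_big /=.
apply: eq_bigr => d _; rewrite mxE sum_mxtens mulr_suml.
rewrite (reindex (@swap _ _)); last by exists (@swap _ _) => -[].
apply: eq_bigr => a _; rewrite mx_of_tensorE ffunE tau_VV_hecke // tau_VdVd_hecke //.
have -> : M (idx (b1, b2)) (idx d) = M (idx d) (idx (b1, b2)).
  by rewrite -[in LHS](tr_hecke_invol n t) [LHS]mxE.
by rewrite mulrA [w _ * _]mulrC.
Qed.

Local Notation T := (inner_hom 'I_n 'I_n (tau_VVd n t)).
Local Notation T' := (inner_hom 'I_n 'I_n (tau_VVd n t)^-1%VF).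

Lemma inner_tauK v : T (T' v) = v.
Proof.
by rewrite -comp_lfunE inner_homM lker0_compfV ?tau_VVd_inj // inner_hom1 id_lfunE.
Qed.

Lemma inner_tauVK v : T' (T v) = v.
Proof.
by rewrite -comp_lfunE inner_homM lker0_compVf ?tau_VVd_inj // inner_hom1 id_lfunE.
Qed.

(** By definition [tau_RE] is the conjugate of [sigma] by the invertible map T. *)
Lemma mem_I_RE w : (T w \in I_RE n t) = (sigma w == - w).
Proof.
rewrite /I_RE /passmx.leigenspace memv_ker add_lfunE opp_lfunE scale_lfunE id_lfunE.
rewrite scaleN1r opprK /tau_RE !comp_lfunE inner_tauVK -linearD.
rewrite -[in RHS]subr_eq0 opprK.
apply/eqP/eqP => [/(congr1 T')|->]; last by rewrite linear0.
by rewrite inner_tauVK linear0.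
Qed.

Local Notation phi := (free_alg_map (@swap 'I_n 'I_n)).

Lemma phi_tensor2_incl w :
  phi (tensor2_incl (T w)) = t^-1 *: mx_pairing (mx_of_tensor w) LSL_mx.
Proof.
rewrite [w in LHS]coord_space_sum (linear_sum T) (linear_sum (@tensor2_incl K n)) /=.
rewrite (raddf_sum phi) /= /mx_pairing sum_mxtens scaler_sumr.
rewrite sum_pairE /=.
rewrite (reindex (@swap _ _)); last by exists (@swap _ _) => -[].
apply: eq_bigr => a _; rewrite sum_mxtens scaler_sumr; apply: eq_bigr => d _.
rewrite mx_of_tensorE scalerA [t^-1 * _]mulrC -[RHS]scalerA (linearZ_LR T).
rewrite (linearZ_LR (@tensor2_incl K n)) (linearZ_LR phi) /=; congr (_ *: _).
rewrite LSL_mxE lin_ext_bas /= (linear_sum (@tensor2_incl K n)) (linear_sum phi).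
rewrite scaler_sumr; apply: eq_bigr => -[b c] _ /=.
rewrite (linearZ_LR (@tensor2_incl K n)) (linearZ_LR phi) /= tensor2_incl_bas.
by rewrite tau_VVd_hecke scalerA (rmorphM phi) /= !free_alg_map_gen.
Qed.

(** S = ((q + q^-1) / 2) M + omega / 2, and the scalar matrix drops out of the commutator. *)
Lemma hecke_commutator (E : 'M[K]_(n * n)) :
  E *m S - S *m E = ((q + q^-1) / 2) *: (E *m M - M *m E).
Proof.
rewrite /M -scalemxAr -scalemxAl mulmxBr mulmxBl -!scalemxAl -!scalemxAr.
rewrite mul_scalar_mx mul_mx_scalar; move: (E *m S) (S *m E) => X Y.
apply/matrixP => i j; rewrite !mxE.
have q0 : q != 0 by apply: expf_neq0.
move: (q) q0 q2_neq0 => x x0 x20; field.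
by rewrite two_neq0 x0 -expr2 addrC x20.
Qed.

Lemma skew_mx_commutator (W : 'M[K]_(n * n)) :
  M *m W *m M = - W -> exists E, W = E *m S - S *m E.
Proof.
(* The commutator of W M with M is W M^2 - M W M = 2 W; the scalar prefactor cancels this 2 against
   the constant of [hecke_commutator]. *)
move=> MWM; exists ((q + q^-1)^-1 *: (W *m M)).
rewrite -scalemxAl -(scalemxAr _ S) -scalerBr hecke_commutator.
rewrite -(mulmxA W M M) hecke_involK // mulmx1 mulmxA MWM opprK scalerA.
have -> : (q + q^-1)^-1 * ((q + q^-1) / 2) = 2^-1.
  have q0 : q != 0 by apply: expf_neq0.
  move: (q) q0 q2_neq0 => x x0 x20; field.
  by rewrite two_neq0 x0 -expr2 addrC x20.
by rewrite -mulr2n -scaler_nat scalerA mulVf // scale1r.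
Qed.

(** Conjugation by the involution M sends E M - M E to M E - E M. *)
Lemma skew_commutator (E : 'M[K]_(n * n)) :
  M *m (E *m S - S *m E) *m M = - (E *m S - S *m E).
Proof.
rewrite hecke_commutator -(scalemxAr _ M) -scalemxAl mulmxBr mulmxBl !mulmxA.
by rewrite hecke_involK // mul1mx -(mulmxA (M *m E)) hecke_involK // mulmx1 -scalerN opprB.
Qed.

Lemma phi_skew_incl v : v \in I_RE n t ->
  ideal_gen [set x | exists a b, x = RE_relation n t a b]%classic
    (phi (tensor2_incl v)).
Proof.
rewrite -(inner_tauK v) mem_I_RE phi_tensor2_incl; move: (T' v) => w /eqP sw.
have [|E ->] := @skew_mx_commutator (mx_of_tensor w).
  by rewrite -mx_of_tensor_sigma sw mx_of_tensorN.
rewrite mx_pairing_commutator; [|exact: free_alg_scalar_comm|exact: hecke_mx_sym].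
rewrite -RE_relationE.
have [I0 ID IM _] := ideal_genP [set x | exists a b, x = RE_relation n t a b]%classic.
have IZ c x : ideal_gen [set x | exists a b, x = RE_relation n t a b]%classic x ->
    ideal_gen [set x | exists a b, x = RE_relation n t a b]%classic (c *: x).
  by move=> Ix; rewrite -[x]mul1r scalerAl; apply: IM.
(* The pairing is a linear combination of the entries of [RE_relation], each a generator of the
   ideal. *)
apply: (IZ); apply: big_ind => // i _; apply: big_ind => // j _.
by apply: IZ; apply: ideal_gen_sub; exists i, j.
Qed.

Lemma phi_RE_relation a b :
  exists2 v, v \in I_RE n t & phi (RE_relation n t a b) = tensor2_incl v.
Proof.
(* Pairing with E = [delta_mx a b] extracts the entry (a, b) of the relation. The factor t in the
   witness below cancels the t^-1 of [phi_tensor2_incl]. *)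
pose w := tensor_of_mx (delta_mx a b *m S - S *m delta_mx a b).
exists (T (t *: w)).
  rewrite mem_I_RE linearZ -scalerN; apply/eqP; congr (_ *: _).
  apply: (can_inj mx_of_tensorK); rewrite mx_of_tensor_sigma tensor_of_mxK.
  rewrite skew_commutator -[in LHS](tensor_of_mxK (_ - _)) -/w.
  by rewrite mx_of_tensorN.
(* Since [phi] is its own inverse, it suffices to write the relation as an image under [phi]. *)
have -> : RE_relation n t a b = phi (tensor2_incl (T (t *: w))).
  rewrite (linearZ_LR T) (linearZ_LR (@tensor2_incl K n)) (linearZ_LR phi) /=.
  rewrite phi_tensor2_incl scalerA divff // scale1r tensor_of_mxK.
  rewrite mx_pairing_commutator; [|exact: free_alg_scalar_comm|exact: hecke_mx_sym].
  by rewrite mx_pairing_delta -RE_relationE.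
by apply: free_alg_mapK => -[].
Qed.

Lemma skew_RE_iso :
  exists f : {rmorphism skew_quotient n t -> RE_alg n t},
    scalable f /\ bijective f.
Proof.
have phiK : cancel phi (phi : A -> A) by apply: free_alg_mapK => -[].
apply: (@alg_quot_iso K A A _ _ phi phi phiK phiK) => [_ [v vI <-]|_ [a [b ->]]].
  exact: phi_skew_incl.
have [v vI RE_v] := phi_RE_relation a b.
by apply: ideal_gen_sub; exists v.
Qed.

End SkewIso.

Theorem theorem6p1 (R : realType) (n : nat) (n_gt0 : (0 < n)%N) :
  exists f : {rmorphism skew_quotient n (q_root R) -> RE_alg n (q_root R)},
    scalable f /\ bijective f.
Proof.
have two_neq0 : 2 != 0 :> q_field R.
  by rewrite -(rmorph_nat (@tofrac {poly R[i]})) tofrac_eq0 -polyC_natr polyC_eq0 pnatr_eq0.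
have q_root_neq0 : q_root R != 0 by rewrite tofrac_eq0 polyX_eq0.
apply: (skew_RE_iso q_root_neq0 _ two_neq0).
rewrite -exprM -tofracXn -tofrac1 -tofracD tofrac_eq0.
(* 1 + q^2 is a polynomial in t whose value at t = 1 is 2, so it is nonzero. *)
apply/eqP => /(congr1 (fun p => p.[1])) /eqP.
by rewrite !hornerE expr1n -[1 + 1]/(2%:R) pnatr_eq0.
Qed.
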